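(* Let $E$ be a homogeneous effect algebra. For every block $B^0$ of $E_S$ and for every block $B$ of $E$ such that $B^0\subseteq B$, we have $B^0=C(B)$.
   Context: An effect algebra is a partial algebra $(E;\oplus,0,1)$ with a partial binary operation $\oplus$ and two constants $0,1$ such that: (E1) if $a\oplus b$ is defined, then $b\oplus a$ is defined and $a\oplus b=b\oplus a$; (E2) if $a\oplus b$ and $(a\oplus b)\oplus c$ are defined, then $b\oplus c$ and $a\oplus(b\oplus c)$ are defined and $(a\oplus b)\oplus c=a\oplus(b\oplus c)$; (E3) for every $a\in E$ there is a unique $a'\in E$ with $a\oplus a'=1$; (E4) if $a\oplus 1$ is defined, then $a=0$. Write $a\le b$ iff there is $c\in E$ with $a\oplus c=b$; this is a partial order with least element $0$ and greatest element $1$, and if $a\le b$ then $b\ominus a$ denotes the unique $c$ with $a\oplus c=b$. Write $a\perp b$ iff $a\oplus b$ is defined. A sub-effect algebra of $E$ is a subset $E_0\subseteq E$ with $1\in E_0$ and $a\ominus b\in E_0$ for all $a,b\in E_0$ with $a\ge b$; it is then an effect algebra with the restricted operation. An effect algebra $E$ satisfies the Riesz decomposition property iff for all $u,v_1,\ldots,v_n\in E$ such that $v_1\oplus\cdots\oplus v_n$ exists and $u\le v_1\oplus\cdots\oplus v_n$, there are $u_1,\ldots,u_n\in E$ with $u_i\le v_i$ for all $i$ and $u=u_1\oplus\cdots\oplus u_n$. A block of an effect algebra is a maximal (with respect to inclusion) sub-effect algebra satisfying the Riesz decomposition property. An effect algebra $E$ is homogeneous iff for all $u,v_1,v_2\in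 E$ such that $v_1\perp v_2$, $u\le v_1\oplus v_2$ and $u\le (v_1\oplus v_2)'$, there are $u_1,u_2\in E$ with $u_1\le v_1$, $u_2\le v_2$ and $u=u_1\oplus u_2$. An element $a\in E$ is sharp iff $a\wedge a'=0$ (i.e. $0$ is the only element below both $a$ and $a'$); $E_S$ is the set of all sharp elements of $E$. For homogeneous $E$, $E_S$ is a sub-effect algebra of $E$ and is an orthoalgebra (i.e. $a\perp a$ implies $a=0$ in $E_S$), so blocks of $E_S$ make sense; a block of an orthoalgebra is the same as a maximal Boolean sub-orthoalgebra. An element $a$ of an effect algebra $E$ is principal iff the interval $[0,a]$ is closed under $\oplus$ (if $x,y\le a$ and $x\perp y$ then $x\oplus y\le a$). A principal element $a$ is central iff every $b\in E$ has a unique decomposition $b=b_1\oplus b_2$ with $b_1\le a$, $b_2\le a'$. The center $C(E)$ is the set of all central elements of $E$; $C(B)$ denotes the center of the effect algebra $B$. *)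

(* Defs.v *)
From mathcomp Require Import all_boot.
From mathcomp Require Import boolp classical_sets.

Set Implicit Arguments.
Unset Strict Implicit.
Unset Printing Implicit Defensive.

Local Open Scope classical_set_scope.

(* [oplus a b = Some c] means that a ⊕ b is defined and equal to c. *)
Record effectAlgebra : Type := EffectAlgebra {
  ea_sort :> Type;
  oplus : ea_sort -> ea_sort -> option ea_sort;
  ea0 : ea_sort;
  ea1 : ea_sort;
  oplusC : forall a b c, oplus a b = Some c -> oplus b a = Some c;
  oplusA : forall a b c ab abc,
    oplus a b = Some ab -> oplus ab c = Some abc ->
    exists2 bc, oplus b c = Some bc & oplus a bc = Some abc;
  ea_compl_uniq : forall a, exists! a', oplus a a' = Some ea1;
  ea_oplus1 : forall a c, oplus a ea1 = Some c -> a = ea0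
}.

Arguments ea0 {e}.
Arguments ea1 {e}.

Declare Scope ea_scope.
Local Open Scope ea_scope.
Notation "a ⊕ b" := (oplus a b) (at level 50, left associativity) : ea_scope.

Definition ea_le (E : effectAlgebra) (a b : E) : Prop :=
  exists c, a ⊕ c = Some b.
Notation "a ≼ b" := (ea_le a b) (at level 70, no associativity) : ea_scope.

Definition ea_compl (E : effectAlgebra) (a : E) : E :=
  sval (cid (ea_compl_uniq a)).

(* ((v_1 ⊕ v_2) ⊕ ...) ⊕ v_n, started at the neutral element 0. *)
Definition osum (E : effectAlgebra) (vs : seq E) : option E :=
  foldl (fun acc v => obind (fun s => s ⊕ v) acc) (Some ea0) vs.

Definition riesz_decomposition (E : effectAlgebra) : Prop :=
  forall (n : nat) (u s : E) (v : n.-tuple E),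
    osum v = Some s -> u ≼ s ->
    exists w : n.-tuple E,
      (forall i, tnth w i ≼ tnth v i) /\ osum w = Some u.

Definition homogeneous (E : effectAlgebra) : Prop :=
  forall u v1 v2 s : E,
    v1 ⊕ v2 = Some s -> u ≼ s -> u ≼ ea_compl s ->
    exists u1 u2, [/\ u1 ≼ v1, u2 ≼ v2 & u1 ⊕ u2 = Some u].

Definition sharp (E : effectAlgebra) (a : E) : Prop :=
  forall x, x ≼ a -> x ≼ ea_compl a -> x = ea0.

Definition principal (E : effectAlgebra) (a : E) : Prop :=
  forall x y z, x ≼ a -> y ≼ a -> x ⊕ y = Some z -> z ≼ a.

Definition central (E : effectAlgebra) (a : E) : Prop :=
  principal a /\
  forall b, exists! p : E * E,
    [/\ p.1 ≼ a, p.2 ≼ ea_compl a & p.1 ⊕ p.2 = Some b].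

Definition center (E : effectAlgebra) : set E := [set a | central a].
Arguments center : clear implicits.

(* In [subEA_ominus], [b ⊕ c = Some a] says that a >= b and c = a ⊖ b. *)
Record subEA (E : effectAlgebra) : Type := SubEA {
  subEA_set : set E;
  subEA1 : subEA_set ea1;
  subEA_ominus : forall a b c,
    subEA_set a -> subEA_set b -> b ⊕ c = Some a -> subEA_set c
}.

Section BasicFacts.
Variable E : effectAlgebra.
Implicit Types a b c : E.

Lemma oplus_compl a : a ⊕ ea_compl a = Some ea1.
Proof. by rewrite /ea_compl; case: (cid _) => x []. Qed.

Lemma compl_eq a b : a ⊕ b = Some ea1 -> b = ea_compl a.
Proof.
move=> h; have [x [_ ux]] := ea_compl_uniq a.
by rewrite -(ux _ h); apply: ux; exact: oplus_compl.
Qed.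

Lemma complK a : ea_compl (ea_compl a) = a.
Proof. exact/esym/compl_eq/oplusC/oplus_compl. Qed.

Lemma compl1 : ea_compl ea1 = ea0 :> E.
Proof. exact: ea_oplus1 (oplusC (oplus_compl ea1)). Qed.

Lemma compl0 : ea_compl ea0 = ea1 :> E.
Proof. by rewrite -compl1 complK. Qed.

Lemma oplus_rot a b s : a ⊕ b = Some s -> b ⊕ ea_compl s = Some (ea_compl a).
Proof.
move=> abs; have [t bt ta] := oplusA abs (oplus_compl s).
by rewrite bt (compl_eq ta).
Qed.

Lemma oplus0 a : a ⊕ ea0 = Some a.
Proof. by have := oplus_rot (oplusC (oplus_compl a)); rewrite compl1 complK. Qed.

Lemma oplus_eq0 a b : a ⊕ b = Some ea0 -> a = ea0.
Proof.
move=> /oplusC /oplus_rot; rewrite compl0 => /ea_oplus1 //.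
Qed.

Lemma ea_le_trans a b c : a ≼ b -> b ≼ c -> a ≼ c.
Proof.
by move=> [x ax] [y ay]; have [z _ az] := oplusA ax ay; exists z.
Qed.

Lemma le_compl_l a b s : a ⊕ b = Some s -> ea_compl s ≼ ea_compl a.
Proof. by move=> /oplus_rot /oplusC h; exists b. Qed.

Lemma subEA_compl (S : subEA E) a : subEA_set S a -> subEA_set S (ea_compl a).
Proof. by move=> Sa; apply: subEA_ominus (oplus_compl a) => //; exact: subEA1. Qed.

Lemma subEA0 (S : subEA E) : subEA_set S ea0.
Proof. by rewrite -compl1; apply/subEA_compl/subEA1. Qed.

Lemma subEA_oplus (S : subEA E) a b c :
  subEA_set S a -> subEA_set S b -> a ⊕ b = Some c -> subEA_set S c.
Proof.
move=> Sa Sb /oplus_rot h; rewrite -(complK c); apply: subEA_compl.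
by apply: subEA_ominus h => //; exact: subEA_compl.
Qed.

End BasicFacts.

Section Induced.
Variables (E : effectAlgebra) (S : subEA E).

Definition subEA_sort : Type := {x : E | x \in subEA_set S}.

Definition sub_oplus (x y : subEA_sort) : option subEA_sort :=
  obind insub (\val x ⊕ \val y).

Lemma sub_oplusE x y z : sub_oplus x y = Some z <-> \val x ⊕ \val y = Some (\val z).
Proof.
rewrite /sub_oplus; case: (\val x ⊕ \val y) => [t|] //=; split.
  by case: insubP => // u _ <- [->].
by move=> [->]; rewrite valK.
Qed.

Definition sub0 : subEA_sort := Sub ea0 (mem_set (subEA0 S)).
Definition sub1 : subEA_sort := Sub ea1 (mem_set (subEA1 S)).

Lemma sub_oplusC x y z : sub_oplus x y = Some z -> sub_oplus y x = Some z.
Proof. by move=> /sub_oplusE /oplusC /sub_oplusE. Qed.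

Lemma sub_oplusA a b c ab abc :
  sub_oplus a b = Some ab -> sub_oplus ab c = Some abc ->
  exists2 bc, sub_oplus b c = Some bc & sub_oplus a bc = Some abc.
Proof.
move=> /sub_oplusE h1 /sub_oplusE h2; have [t bct at_] := oplusA h1 h2.
have St : subEA_set S t.
  exact: subEA_oplus (set_mem (valP b)) (set_mem (valP c)) bct.
by exists (Sub t (mem_set St)); apply/sub_oplusE; rewrite SubK.
Qed.

Lemma sub_compl_uniq a : exists! a', sub_oplus a a' = Some sub1.
Proof.
have Sa := subEA_compl (set_mem (valP a)).
exists (Sub (ea_compl (\val a)) (mem_set Sa)); split.
  by apply/sub_oplusE; rewrite SubK; exact: oplus_compl.
by move=> y /sub_oplusE /= /compl_eq h; apply: val_inj.
Qed.

Lemma sub_oplus1 a c : sub_oplus a sub1 = Some c -> a = sub0.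
Proof. by move=> /sub_oplusE /= /ea_oplus1 h; apply: val_inj. Qed.

Definition induced : effectAlgebra :=
  EffectAlgebra sub_oplusC sub_oplusA sub_compl_uniq sub_oplus1.

Definition subEA_incl (x : induced) : E := \val (x : subEA_sort).

End Induced.

Definition block (E : effectAlgebra) (B : subEA E) : Prop :=
  riesz_decomposition (induced B) /\
  forall B' : subEA E,
    riesz_decomposition (induced B') -> subEA_set B `<=` subEA_set B' ->
    subEA_set B' `<=` subEA_set B.

Section SharpElements.
Variables (E : effectAlgebra) (hE : homogeneous E).

Lemma sharp1 : sharp (ea1 : E).
Proof.
by move=> x _; rewrite compl1 => -[y /oplus_eq0].
Qed.

Lemma sharp_compl (a : E) : sharp a -> sharp (ea_compl a).
Proof. by move=> sa x h1; rewrite complK => h2; apply: sa. Qed.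

Lemma sharp_oplus (a b s : E) : sharp a -> sharp b -> a ⊕ b = Some s -> sharp s.
Proof.
move=> sa sb abs x xs xs'.
have [u1 [u2 [u1a u2b u12]]] := hE abs xs xs'.
have u1x : u1 ≼ x by exists u2.
have u2x : u2 ≼ x by exists u1; apply: oplusC.
have u10 : u1 = ea0.
  by apply: sa => //; apply: ea_le_trans u1x (ea_le_trans xs' (le_compl_l abs)).
have u20 : u2 = ea0.
  apply: sb => //; apply: ea_le_trans u2x (ea_le_trans xs' _).
  exact: le_compl_l (oplusC abs).
by move: u12; rewrite u10 u20 oplus0 => -[].
Qed.

Lemma sharp_ominus (a b c : E) :
  [set x : E | sharp x] a -> [set x : E | sharp x] b -> b ⊕ c = Some a ->
  [set x : E | sharp x] c.
Proof.
move=> /= sa sb /oplusC /oplus_rot h; rewrite -(complK c).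
exact/sharp_compl/(sharp_oplus sb (sharp_compl sa) h).
Qed.

Definition sharpEA : subEA E :=
  @SubEA E [set x | sharp x] sharp1 sharp_ominus.

End SharpElements.

(* Main.v *)
Require Import Defs.
From Stdlib Require List.
From HB Require Import structures.
From mathcomp Require Import all_boot.
From mathcomp Require Import boolp classical_sets.

Local Open Scope classical_set_scope.
Local Open Scope ea_scope.
Set Implicit Arguments.
Unset Strict Implicit.
Unset Printing Implicit Defensive.

(** The block [B0] consists of the sharp elements of [E] lying in [B], and these
    are exactly the central elements of [B].

    In an effect algebra with the Riesz decomposition property, sharp and
    central elements coincide ([central_sharp], [sharp_central]), and the
    components of a sharp element along a sum of sharp elements are sharp
    ([sharp_split]).  Hence, once sharpness in [B] is known to agree with
    sharpness in [E] ([block_sharp]), the sharp elements of [E] in [B] form a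
    sub-effect algebra of [E_S] with the Riesz property ([sharp_part_riesz]).
    It contains [B0], so it equals [B0] by maximality, and it is the center.

    The substance is that a sharp element of a block stays sharp in [E].  It
    suffices that a block [B] contains every [t] below both [v] and its
    complement, for [v] in [B] ([block_below]).  Call a subset [M]
    internally compatible if each of its finite subsets is covered by an
    orthogonal family of elements of [M] with sum 1, meaning that each member of
    the finite subset is a sum of members of the family.  A sub-effect algebra
    with the Riesz property is internally compatible ([riesz_compatible]), so
    by Zorn's lemma it lies in a maximal internally compatible [M].  This [M]
    contains every such [t], because homogeneity splits [t] along any partition
    of 1 that covers [v], and adjoining all remainders produced in this way
    keeps [M] compatible ([adjoin_compatible]).  Moreover [M] is itself a
    sub-effect algebra with the Riesz property.  The difficulty there is that
    two orthogonal elements may be covered by overlapping subfamilies; their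
    common part is then repeated in the complement of both, and splitting the
    complement along it makes the two subfamilies disjoint
    ([disjoint_refinement]).  If [B] is a block, then [B] equals [M]. *)

(** * Order and cancellation *)

Section Order.
Variable E : effectAlgebra.
Implicit Types a b c s t u v : E.

Lemma oplus_cancel a b c s : a ⊕ b = Some s -> a ⊕ c = Some s -> b = c.
Proof.
move=> /oplus_rot /oplus_rot + /oplus_rot /oplus_rot.
by move=> -> [] /(congr1 (@ea_compl E)); rewrite !complK.
Qed.

Lemma oplus0l a : ea0 ⊕ a = Some a.
Proof. exact/oplusC/oplus0. Qed.

Lemma ea_le_refl a : a ≼ a.
Proof. by exists ea0; exact: oplus0. Qed.

Lemma ea_le0 a : ea0 ≼ a.
Proof. by exists a; exact: oplus0l. Qed.

Lemma ea_le1 a : a ≼ ea1.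
Proof. by exists (ea_compl a); exact: oplus_compl. Qed.

Lemma le_oplusl a b s : a ⊕ b = Some s -> a ≼ s.
Proof. by exists b. Qed.

Lemma le_oplusr a b s : a ⊕ b = Some s -> b ≼ s.
Proof. by move=> /oplusC; exact: le_oplusl. Qed.

Lemma le0_eq a : a ≼ ea0 -> a = ea0.
Proof. by case=> c /oplus_eq0. Qed.

Lemma ea_le_anti a b : a ≼ b -> b ≼ a -> a = b.
Proof.
move=> [x ax] [y bY]; have [z xy az] := oplusA ax bY.
have z0 : ea0 = z := oplus_cancel (oplus0 a) az.
by move: xy; rewrite -z0 => /oplus_eq0 x0; move: ax; rewrite x0 oplus0 => -[].
Qed.

Lemma le_compl a b : a ≼ b -> ea_compl b ≼ ea_compl a.
Proof. by case=> c; exact: le_compl_l. Qed.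

Lemma le_complC a b : a ≼ ea_compl b -> b ≼ ea_compl a.
Proof. by move=> /le_compl; rewrite complK. Qed.

Lemma oplus_le_compl a b s : a ⊕ b = Some s -> a ≼ ea_compl b.
Proof. by move=> /oplusC /oplus_rot /le_oplusl. Qed.

End Order.

(** * Finite sums *)

Section OptionSum.
Variable E : effectAlgebra.
Implicit Types x y z : option E.

(** Propagating undefinedness turns the partial sum into a total commutative
    monoid law, so that iterated big operators apply to it. *)
Definition oadd x y : option E :=
  if x is Some a then (if y is Some b then a ⊕ b else None) else None.

Lemma oaddC : commutative oadd.
Proof.
move=> [a|] [b|] //=; case h : (a ⊕ b) => [c|].
  exact/esym/oplusC.
by case h' : (b ⊕ a) => [c|] //; rewrite (oplusC h') in h.
Qed.

Lemma oadd0l : left_id (Some ea0) oadd.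
Proof. by move=> [a|] //=; exact: oplus0l. Qed.

Lemma oaddA : associative oadd.
Proof.
have half x y z s : oadd (oadd x y) z = Some s -> oadd x (oadd y z) = Some s.
  case: x y z => [a|] [b|] [c|] //=; last by case: (a ⊕ b).
  case h : (a ⊕ b) => [ab|] // h'; have [bc h1 h2] := oplusA h h'.
  by rewrite h1 /= h2.
move=> x y z; case h : (oadd (oadd x y) z) => [s|]; first exact: half.
case h' : (oadd x (oadd y z)) => [s|] //; move: h' h.
by rewrite oaddC (oaddC y) => /half; rewrite oaddC (oaddC y) => ->.
Qed.

HB.instance Definition _ :=
  Monoid.isComLaw.Build (option E) (Some ea0) oadd oaddA oaddC oadd0l.

Lemma oaddACA : interchange oadd oadd.
Proof. exact: Monoid.mulmACA. Qed.

Lemma oaddP x y s : oadd x y = Some s ->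
  exists a b, [/\ x = Some a, y = Some b & a ⊕ b = Some s].
Proof. by case: x y => [a|] [b|] //= h; exists a, b. Qed.

Definition fsum (I : finType) (c : I -> E) (A : pred I) : option E :=
  \big[oadd/Some ea0]_(i | A i) Some (c i).

Section FiniteSums.
Variables (I : finType) (c : I -> E).
Implicit Types A P : pred I.

Lemma fsumID P A : fsum c A =
  oadd (fsum c [pred i | A i && P i]) (fsum c [pred i | A i && ~~ P i]).
Proof. exact: bigID. Qed.

Lemma fsumD1 i A : A i ->
  fsum c A = oadd (Some (c i)) (fsum c [pred j | A j && (j != i)]).
Proof. exact: bigD1. Qed.

Lemma fsum_pred1 i : fsum c (pred1 i) = Some (c i).
Proof. exact: big_pred1_eq. Qed.

Lemma eq_fsum A P : A =1 P -> fsum c A = fsum c P.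
Proof. exact: eq_bigl. Qed.

Lemma fsum_sub A P s : fsum c A = Some s -> {subset P <= A} ->
  exists2 t, fsum c P = Some t & t ≼ s.
Proof.
move=> h PA; move: h; rewrite (fsumID P) => /oaddP[a [b [h _ /le_oplusl]]].
exists a => //; rewrite -h; apply: eq_fsum => i /=.
by case Pi : (P i); rewrite ?andbF// andbT; exact/esym/PA.
Qed.

Lemma fsum_le A i s : fsum c A = Some s -> A i -> c i ≼ s.
Proof.
move=> h Ai; move: h.
by rewrite (fsumD1 Ai) => /oaddP[a [b [[->] _ /le_oplusl]]].
Qed.

Lemma fsumU A P : (forall i, A i -> P i -> False) ->
  oadd (fsum c A) (fsum c P) = fsum c [pred i | A i || P i].
Proof.
move=> dis; rewrite [RHS](fsumID A); congr oadd; apply: eq_fsum => i /=.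
  by case: (A i); rewrite // andbF.
by have := dis i; case: (A i); case: (P i) => //= /(_ isT isT).
Qed.

End FiniteSums.

(** Abstracts the passage from a splitting of [t] along two summands to one
    along finitely many.  [G t s] is the condition under which [t] splits along
    decompositions of [s], and is inherited by the parts: with [t ≼ s] it serves
    for the Riesz property, with [t] below [s] and its complement for
    homogeneity.  Outside of [A] the splitting is the trivial one. *)
Lemma split_fsum (S : set E) (G : E -> E -> Prop)
    (G_le : forall t s, G t s -> t ≼ s)
    (G_split : forall t a b s, S a -> G t s -> a ⊕ b = Some s ->
       exists t1 t2, [/\ G t1 a, G t2 b & t1 ⊕ t2 = Some t])
    (I : finType) (c : I -> E) (A : pred I) s t :
  (forall i, A i -> S (c i)) -> fsum c A = Some s -> G t s ->
  exists d e, [/\ forall i, d i ⊕ e i = Some (c i),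
    forall i, A i -> G (d i) (c i),
    forall i, ~~ A i -> d i = ea0 /\ e i = c i & fsum d A = Some t].
Proof.
move=> SA cA Gt.
suff [d [dG d0 dt]] : exists d, [/\ forall i, A i -> G (d i) (c i),
    forall i, ~~ A i -> d i = ea0 & fsum d A = Some t].
  have /choice[e de] i : exists e, d i ⊕ e = Some (c i).
    case Ai : (A i); first exact/G_le/dG.
    by exists (c i); rewrite d0 ?Ai// oplus0l.
  exists d, e; split=> // i Ai; split; first exact: d0.
  by have := de i; rewrite (d0 _ Ai) oplus0l => -[].
have [n] := ubnP #|A|.
elim: n => // n IH in A s t SA cA Gt * => An.
have [i Ai|A0] := pickP A; last first.
  have s0 : s = ea0 by move: cA; rewrite /fsum big_pred0 // => -[].
  exists (fun=> ea0); split=> // [i|]; first by rewrite A0.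
  by rewrite /fsum big_pred0 // -(@le0_eq _ t)// -s0; exact: G_le.
move: cA; rewrite (fsumD1 _ Ai) => /oaddP[_ [b [[<-] cb ab]]].
have [t1 [t2 [G1 G2 t12]]] := G_split _ _ _ _ (SA _ Ai) Gt ab.
have [||d [dG d0 dt]] := IH _ _ _ _ cb G2.
- by move=> j /andP[/SA].
- move: An; rewrite (cardD1 i) unfold_in Ai ltnS; apply: leq_trans.
  by rewrite add1n ltnS; apply/eq_leq/eq_card => j; rewrite !unfold_in andbC.
exists (fun j => if j == i then t1 else d j); split.
- by move=> j Aj; case: eqP => [->//|/eqP ji]; apply: dG; rewrite /= Aj.
- move=> j Aj; case: eqP => [ji|_]; first by rewrite ji Ai in Aj.
  by apply: d0; rewrite /= (negbTE Aj).
rewrite (fsumD1 _ Ai) eqxx -t12 -[RHS]/(oadd (Some t1) (Some t2)) -dt.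
congr oadd.
by apply: eq_bigr => j /andP[_ /negbTE->].
Qed.

(** * Orthogonal partitions of 1 and their refinements *)

Record orthopartition := Orthopartition {
  idx : finType;
  piece : idx -> E;
  piece_sum : fsum piece xpredT = Some ea1
}.

Lemma unit_partition_sum : fsum (fun=> ea1) (xpredT : pred unit) = Some ea1.
Proof. by rewrite (@eq_fsum _ _ _ (pred1 tt)) ?fsum_pred1 // => -[]. Qed.

Definition unit_partition := Orthopartition unit_partition_sum.

Definition covers (D : orthopartition) (a : E) :=
  exists A : pred (idx D), fsum (@piece D) A = Some a.

Definition pieces_in (M : set E) (D : orthopartition) :=
  forall i : idx D, M (piece i).

(** A weak form of refinement: no map between the index types is recorded, only
    that sums of subfamilies survive. *)
Definition refines (D D' : orthopartition) :=
  forall a, covers D a -> covers D' a.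

Lemma refines_trans D1 D2 D3 : refines D1 D2 -> refines D2 D3 -> refines D1 D3.
Proof. by move=> h12 h23 a /h12/h23. Qed.

Section Split.
Variables (D : orthopartition) (d e : idx D -> E).
Hypothesis de : forall i, d i ⊕ e i = Some (piece i).

Definition split_piece (p : idx D * bool) : E := if p.2 then d p.1 else e p.1.

Lemma fsum_split_piece (A : pred (idx D)) :
  fsum split_piece [pred p | A p.1] = fsum (@piece D) A.
Proof.
rewrite /fsum (eq_bigl (fun p : idx D * bool => A p.1 && true)); last first.
  by move=> p; rewrite andbT.
rewrite -(pair_big A predT (fun i j => Some (split_piece (i, j)))).
by apply: eq_bigr => i _; rewrite big_bool; exact: de.
Qed.

Lemma fsum_split_left (A : pred (idx D)) :
  fsum split_piece [pred p | A p.1 && p.2] = fsum d A.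
Proof.
rewrite /fsum -(pair_big A id (fun i j => Some (split_piece (i, j)))).
by apply: eq_bigr => i _; rewrite (big_pred1 true)// => -[].
Qed.

Definition split_partition : orthopartition :=
  @Orthopartition (idx D * bool)%type split_piece
    (etrans (fsum_split_piece xpredT) (piece_sum D)).

Lemma refines_split : refines D split_partition.
Proof.
by move=> a [A h]; exists [pred p | A p.1]; rewrite -h; exact: fsum_split_piece.
Qed.

Lemma pieces_in_split (M : set E) :
  (forall i, M (d i) /\ M (e i)) -> pieces_in M split_partition.
Proof. by move=> h [i []]; case: (h i). Qed.

End Split.

Lemma piece_disjoint (D : orthopartition) (A P : pred (idx D)) a b :
  fsum (@piece D) A = Some a -> fsum (@piece D) P = Some b ->
  (forall i, A i -> P i -> False) -> a ≼ ea_compl b.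
Proof.
move=> Aa Pb dis.
have [t h _] :=
  fsum_sub (piece_sum D) (P := [pred i | A i || P i]) (fun _ _ => isT).
by move: h; rewrite -fsumU// Aa Pb => /oplus_le_compl.
Qed.

Lemma covers_compl D a : covers D a -> covers D (ea_compl a).
Proof.
move=> [A h]; exists [pred i | ~~ A i].
have := piece_sum D; rewrite (fsumID _ A) => /oaddP[x [y [hx hy /compl_eq]]].
have -> : a = x by apply/Some_inj; rewrite -h -hx; exact: eq_fsum.
by move=> <-; rewrite -hy; exact: eq_fsum.
Qed.

Lemma fsum_in (M : set E) (I : finType) (c : I -> E) (A : pred I) s :
  M ea0 -> (forall a b t, M a -> M b -> a ⊕ b = Some t -> M t) ->
  (forall i, A i -> M (c i)) -> fsum c A = Some s -> M s.
Proof.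
move=> M0 MD Mc.
suff : forall s, fsum c A = Some s -> M s by apply.
apply: (big_ind (fun x => forall s, x = Some s -> M s)).
- by move=> _ [<-].
- move=> x y hx hy t /oaddP[a [b [xa yb]]]; apply: MD; [exact: hx|exact: hy].
- by move=> i /Mc Mi _ [<-].
Qed.

Definition internally_compatible (M : set E) :=
  forall F : seq E, List.Forall M F ->
  exists D, pieces_in M D /\ List.Forall (covers D) F.

End OptionSum.

(** * The Riesz property for two summands, and induced effect algebras *)

(** The components are required to lie in [S], while the order is that of [E];
    for a sub-effect algebra this is the Riesz property of the induced algebra,
    see [riesz_induced]. *)
Definition riesz2 (E : effectAlgebra) (S : set E) :=
  forall u v1 v2 s : E, S u -> S v1 -> S v2 -> S s ->
    v1 ⊕ v2 = Some s -> u ≼ s ->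
    exists u1 u2, [/\ (S u1 /\ u1 ≼ v1), (S u2 /\ u2 ≼ v2) & u1 ⊕ u2 = Some u].

Lemma osumE (E : effectAlgebra) (vs : seq E) :
  osum vs = \big[@oadd E/Some ea0]_(v <- vs) Some v.
Proof.
suff h x : foldl (fun acc v => obind (fun s => s ⊕ v) acc) x vs =
    oadd x (\big[@oadd E/Some ea0]_(v <- vs) Some v) by rewrite -[RHS]oadd0l -h.
elim: vs x => [|v vs IH] x /=; first by rewrite big_nil oaddC oadd0l.
rewrite IH big_cons oaddA; congr oadd; by case: x.
Qed.

Lemma riesz2_setT (E : effectAlgebra) :
  riesz_decomposition E <-> riesz2 [set: E].
Proof.
split=> [rdp u v1 v2 s _ _ _ _ v12 us | rdp n u s v].
  have [|w [wv]] := rdp 2 u s [tuple v1; v2] _ us.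
    by rewrite /osum /= oplus0l.
  case: w wv => [[|w1 [|w2 []]] // sw] wv.
  rewrite osumE !big_cons big_nil /= oplus0 => wu.
  have := (wv ord0, wv (inord 1)).
  rewrite !(tnth_nth ea0) inordK //= => -[h1 h2].
  by exists w1, w2.
rewrite osumE big_tuple => vs us.
have [|d [e [_ dv _ du]]] :=
  @split_fsum E setT (@ea_le E) (fun _ _ h => h) _ _ (tnth v) xpredT s u
    (fun _ _ => I) vs us.
  move=> t a b s' _ ts' ab.
  have [t1 [t2 [[_ h1] [_ h2] h]]] := rdp t a b s' I I I I ab ts'.
  by exists t1, t2.
exists [tuple d i | i < n]; split=> [i|].
  by rewrite tnth_mktuple; exact: dv.
by rewrite osumE big_map big_enum.
Qed.

Section InducedOrder.
Variables (E : effectAlgebra) (S : subEA E).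
Implicit Types x y : induced S.

Lemma subEA_inclP x : subEA_set S (subEA_incl x).
Proof. exact: set_mem (valP x). Qed.

Lemma subEA_incl_inj : injective (@subEA_incl E S).
Proof. exact: val_inj. Qed.

Lemma subEA_incl_onto a : subEA_set S a -> exists x, @subEA_incl E S x = a.
Proof. by move=> Sa; exists (Sub a (mem_set Sa)); exact: SubK. Qed.

Lemma oplus_induced x y (z : induced S) :
  x ⊕ y = Some z <-> subEA_incl x ⊕ subEA_incl y = Some (subEA_incl z).
Proof. exact: sub_oplusE. Qed.

Lemma le_induced x y : x ≼ y <-> subEA_incl x ≼ subEA_incl y.
Proof.
split=> [[z /oplus_induced xz]|[c xc]]; first by exists (subEA_incl z).
have Sc := subEA_ominus (subEA_inclP y) (subEA_inclP x) xc.
by have [z zc] := subEA_incl_onto Sc; exists z; apply/oplus_induced; rewrite zc.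
Qed.

Lemma compl_induced x : subEA_incl (ea_compl x) = ea_compl (subEA_incl x).
Proof.
by apply: compl_eq; exact: (oplus_induced x _ ea1).1 (oplus_compl x).
Qed.

Lemma riesz_induced :
  riesz_decomposition (induced S) <-> riesz2 (subEA_set S).
Proof.
rewrite riesz2_setT; split=> h.
  move=> u v1 v2 s /subEA_incl_onto[u' <-] /subEA_incl_onto[v1' <-].
  move=> /subEA_incl_onto[v2' <-] /subEA_incl_onto[s' <-].
  move=> /oplus_induced v12 /le_induced us.
  have [u1 [u2 [[_ /le_induced h1] [_ /le_induced h2] /oplus_induced h12]]] :=
    h _ _ _ _ I I I I v12 us.
  exists (subEA_incl u1), (subEA_incl u2).
  by split=> //; split=> //; exact: subEA_inclP.
move=> u v1 v2 s _ _ _ _ /oplus_induced v12 /le_induced us.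
have [u1 [u2 [[/subEA_incl_onto[w1 <-] h1] [/subEA_incl_onto[w2 <-] h2] h12]]]
  := h _ _ _ _ (subEA_inclP u) (subEA_inclP v1) (subEA_inclP v2)
       (subEA_inclP s) v12 us.
exists w1, w2; split; last exact/oplus_induced.
  by split=> //; exact/le_induced.
by split=> //; exact/le_induced.
Qed.

End InducedOrder.

(** * Sharp and central elements *)

(** The pairs [(x, 0)] and [(0, x)] both decompose an [x] below [a] and its
    complement. *)
Lemma central_sharp (F : effectAlgebra) (a : F) : central a -> sharp a.
Proof.
move=> [_ /(_ _)] ca x xa xa'; have [p [_ up]] := ca x.
have h1 : p = (x, ea0).
  by apply: up; split=> //=; [exact: ea_le0|exact: oplus0].
have h2 : p = (ea0, x).
  by apply: up; split=> //=; [exact: ea_le0|exact: oplus0l].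
by move: h2; rewrite h1 => -[].
Qed.

Section RieszCentral.
Variables (E : effectAlgebra) (rdp : riesz2 [set: E]).
Implicit Types a b u : E.

Let split2 u v1 v2 s : v1 ⊕ v2 = Some s -> u ≼ s ->
  exists u1 u2, [/\ u1 ≼ v1, u2 ≼ v2 & u1 ⊕ u2 = Some u].
Proof.
move=> v12 us; have [u1 [u2 [[_ h1] [_ h2] h]]] := rdp I I I I v12 us.
by exists u1, u2.
Qed.

(** The component of [x] along [p2] is below both [a] and its complement; so
    [p1] is the greatest lower bound of [a] and [b], whence its uniqueness. *)
Lemma sharp_component_le a b p1 p2 : sharp a ->
  p1 ≼ a -> p2 ≼ ea_compl a -> p1 ⊕ p2 = Some b ->
  forall x, x ≼ a -> x ≼ b -> x ≼ p1.
Proof.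
move=> sa p1a p2a' p12 x xa xb; have [r [s [rp sp rs]]] := split2 p12 xb.
have s0 : s = ea0.
  apply: sa; first exact: ea_le_trans (le_oplusr rs) xa.
  exact: ea_le_trans sp p2a'.
by move: rs; rewrite s0 oplus0 => -[<-].
Qed.

(** The part of [z] below the complement of [a] splits along [x] and [y], and
    both of its components are below [a]. *)
Lemma sharp_principal a : sharp a -> principal a.
Proof.
move=> sa x y z xa ya xy.
have [z1 [z2 [z1a z2a' z12]]] := split2 (oplus_compl a) (ea_le1 z).
have [p [q [px qy pq]]] := split2 xy (le_oplusr z12).
have p0 : p = ea0.
  apply: sa; first exact: ea_le_trans px xa.
  exact: ea_le_trans (le_oplusl pq) z2a'.
have q0 : q = ea0.
  apply: sa; first exact: ea_le_trans qy ya.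
  exact: ea_le_trans (le_oplusr pq) z2a'.
move: pq z12; rewrite p0 q0 oplus0 => -[<-].
by rewrite oplus0 => -[<-].
Qed.

Lemma sharp_central a : sharp a -> central a.
Proof.
move=> sa; split; first exact: sharp_principal.
move=> b; have [p1 [p2 [p1a p2a' p12]]] := split2 (oplus_compl a) (ea_le1 b).
exists (p1, p2); split=> // -[q1 q2] [/= q1a q2a' q12].
have e1 : p1 = q1.
  apply: ea_le_anti.
    exact: sharp_component_le q1a q2a' q12 _ p1a (le_oplusl p12).
  exact: sharp_component_le p1a p2a' p12 _ q1a (le_oplusl q12).
by rewrite -e1 in q12 *; rewrite (oplus_cancel p12 q12).
Qed.

(** The complement of [u1] is [u2] plus the complement of [u]: a lower bound of
    [u1] and this complement has a component below [v2], killed by sharpness of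
    [v2], and one below the complement of [u], killed by sharpness of [u]. *)
Lemma sharp_split u v1 v2 u1 u2 s : sharp u -> sharp v2 -> v1 ⊕ v2 = Some s ->
  u1 ≼ v1 -> u2 ≼ v2 -> u1 ⊕ u2 = Some u -> sharp u1.
Proof.
move=> su sv2 v12 u1v1 u2v2 u12 x xu1 xu1'.
have [x1 [x2 [h1 h2 h]]] := split2 (oplusC (oplus_rot u12)) xu1'.
have x10 : x1 = ea0.
  apply: su => //; apply: ea_le_trans (le_oplusl h) _.
  exact: ea_le_trans xu1 (le_oplusl u12).
have x20 : x2 = ea0.
  apply: sv2; first exact: ea_le_trans h2 u2v2.
  apply: ea_le_trans (le_oplusr h) _; apply: ea_le_trans xu1 _.
  exact: ea_le_trans u1v1 (oplus_le_compl v12).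
by move: h; rewrite x10 x20 oplus0 => -[].
Qed.

End RieszCentral.

(** * Internally compatible sets *)

(** Each further element of the finite set lies below 1, hence splits along the
    partition built so far. *)
Lemma riesz_compatible (E : effectAlgebra) (B : subEA E) :
  riesz2 (subEA_set B) -> internally_compatible (subEA_set B).
Proof.
move=> rdp F; elim=> [|f {}F Bf BF [D [DB DF]]].
  exists (unit_partition E).
  by split=> // i; exact: subEA1.
have [||d [e [de dG dA df]]] := @split_fsum E (subEA_set B)
  (fun t s => [/\ subEA_set B t, subEA_set B s & t ≼ s])
  (fun _ _ h => let: And3 _ _ ts := h in ts) _ _ _ xpredT _ f
  (fun i _ => DB i) (piece_sum D) _.
- move=> t a b s Ba [Bt Bs ts] ab; have Bb := subEA_ominus Bs Ba ab.
  have [t1 [t2 [[? ?] [? ?] ?]]] := rdp _ _ _ _ Bt Ba Bb Bs ab ts.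
  by exists t1, t2.
- by split=> //; [exact: subEA1|exact: ea_le1].
exists (split_partition de); split.
  apply: pieces_in_split => i; have [Bd _ _] := dG i isT; split=> //.
  exact: subEA_ominus (DB i) Bd (de i).
constructor.
  by exists [pred p | xpredT p.1 && p.2]; rewrite -df; exact: fsum_split_left.
by apply: List.Forall_impl DF; exact: refines_split.
Qed.

Lemma homogeneous_split (E : effectAlgebra) (hE : homogeneous E)
    (I : finType) (c : I -> E) (A : pred I) s t :
  fsum c A = Some s -> t ≼ s -> t ≼ ea_compl s ->
  exists d e, [/\ forall i, d i ⊕ e i = Some (c i),
    forall i, A i -> d i ≼ t,
    forall i, ~~ A i -> d i = ea0 /\ e i = c i & fsum d A = Some t].
Proof.
move=> cA ts ts'.
have [|d [e [de _ dA dt]]] := @split_fsum E setT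
  (fun t s => t ≼ s /\ t ≼ ea_compl s) (fun _ _ h => h.1) _ _ _ _ _ _
  (fun _ _ => Logic.I) cA (conj ts ts').
  move=> {ts ts' cA}{}t a b {}s _ [ts ts'] ab.
  have [t1 [t2 [h1 h2 h]]] := hE _ _ _ _ ab ts ts'.
  exists t1, t2; split=> //; split=> //.
    exact: ea_le_trans (le_oplusl h) (ea_le_trans ts' (le_compl_l ab)).
  exact: ea_le_trans (le_oplusr h) (ea_le_trans ts' (le_compl_l (oplusC ab))).
exists d, e; split=> // i; exact: fsum_le.
Qed.

(** ** Adjoining an element below [v] and its complement *)

Section Adjoin.
Variables (E : effectAlgebra) (hE : homogeneous E) (M : set E).
Hypothesis icM : internally_compatible M.
Variables (v u : E).
Hypotheses (Mv : M v) (uv : u ≼ v) (uv' : u ≼ ea_compl v).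

(** The pieces that appear when partitions in [M] are repeatedly split along
    elements below [u].  The pieces taken from [M] must be below [v] or below its
    complement, so that each remainder is orthogonal to [u] and homogeneity
    can be used again on it. *)
Inductive remainder : E -> Prop :=
| remainder_base c : M c -> c ≼ v \/ c ≼ ea_compl v -> remainder c
| remainder_small t : t ≼ u -> remainder t
| remainder_ominus d t e :
    remainder d -> t ≼ u -> t ⊕ e = Some d -> remainder e.

Lemma remainder_le d : remainder d -> d ≼ v \/ d ≼ ea_compl v.
Proof.
elim=> [//|t tu|{}d t e _ [] dv _ /le_oplusr ed].
- by left; exact: ea_le_trans tu uv.
- by left; exact: ea_le_trans ed dv.
- by right; exact: ea_le_trans ed dv.
Qed.

Lemma remainder_small_compl d t : remainder d -> t ≼ u -> t ≼ ea_compl d.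
Proof.
move=> /remainder_le[] dv tu; apply: ea_le_trans tu _.
  exact: ea_le_trans uv' (le_compl dv).
by apply: ea_le_trans uv _; exact: le_complC.
Qed.

(** Once a partition into remainders covers [d], splitting it along [t] makes it
    cover [t] and what [t] leaves of [d].  So covering [q] only requires covering
    [v] and the one element [m] of [M] from which [q] is carved. *)
Lemma remainder_cover q : remainder q -> exists2 m, M m &
  forall D, pieces_in remainder D -> covers D m -> covers D v ->
  exists D', [/\ pieces_in remainder D', refines D D' & covers D' q].
Proof.
have cut D (A : pred (idx D)) s t :
    pieces_in remainder D -> fsum (@piece _ D) A = Some s ->
    t ≼ u -> t ≼ s -> t ≼ ea_compl s ->
    exists D', [/\ pieces_in remainder D', refines D D', covers D' t &
      forall e, t ⊕ e = Some s -> covers D' e].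
  move=> rD As tu ts ts'.
  have [d [e [de dt d0 dA]]] := homogeneous_split hE As ts ts'.
  have st : fsum (split_piece d e) [pred p | A p.1 && p.2] = Some t.
    by rewrite fsum_split_left.
  exists (split_partition de); split.
  - apply: pieces_in_split => i; case Ai : (A i).
      have du := ea_le_trans (dt _ Ai) tu; split; first exact: remainder_small.
      exact: remainder_ominus (rD i) du (de i).
    have [-> ->] := d0 i (negbT Ai); split; last exact: rD.
    by apply: remainder_small; exact: ea_le0.
  - exact: refines_split.
  - by exists [pred p | A p.1 && p.2].
  move=> e' te'; exists [pred p | A p.1 && ~~ p.2].
  have := fsum_split_piece de A; rewrite As (fsumID _ [pred p | p.2]).
  move=> /oaddP[t' [f [h1 h2 h3]]].
  have tt' : t = t' by move: h1; rewrite [LHS](_ : _ = Some t)// => -[].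
  by rewrite -tt' in h3; rewrite [LHS]h2 (oplus_cancel te' h3).
elim=> [c Mc cv|t tu|d t e rd [m Mm IH] tu te].
- by exists c => // D rD Dc _; exists D; split.
- exists v => // D rD _ [A Av].
  have [D' [h1 h2 h3 _]] :=
    cut _ _ _ _ rD Av tu (ea_le_trans tu uv) (ea_le_trans tu uv').
  by exists D'.
- exists m => // D rD Dm Dv; have [D' [rD' DD' [A Ad]]] := IH _ rD Dm Dv.
  have [D2 [h1 h2 _ h3]] :=
    cut _ _ _ _ rD' Ad tu (le_oplusl te) (remainder_small_compl rd tu).
  by exists D2; split=> //; [exact: refines_trans h2|exact: h3].
Qed.

(** A finite subset is traced back to finitely many elements of [M]; a partition
    in [M] covering these and [v] has all its pieces below [v] or below its
    complement, so it is a partition into remainders, ready to be refined. *)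
Lemma adjoin_compatible : internally_compatible (M `|` remainder).
Proof.
move=> F MF.
have [F0 [MF0 hF]] : exists F0, List.Forall M F0 /\ forall D,
    pieces_in remainder D -> covers D v -> List.Forall (covers D) F0 ->
    exists D', [/\ pieces_in remainder D', refines D D' &
      List.Forall (covers D') F].
  elim: MF => [|f {}F Mf _ [F0 [MF0 IH]]].
    by exists [::]; split=> // D rD _ _; exists D; split.
  have [m Mm hm] : exists2 m, M m &
      forall D, pieces_in remainder D -> covers D m -> covers D v ->
      exists D', [/\ pieces_in remainder D', refines D D' & covers D' f].
    case: Mf => [Mf|]; last exact: remainder_cover.
    by exists f => // D rD Df _; exists D; split.
  exists (m :: F0); split; first by constructor.
  move=> D rD Dv /List.Forall_cons_iff[Dm DF0].
  have [D1 [r1 DD1 F1]] := IH _ rD Dv DF0.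
  have [D2 [r2 DD2 F2]] := hm _ r1 (DD1 _ Dm) (DD1 _ Dv).
  exists D2; split=> //; first exact: refines_trans DD2.
  by constructor=> //; apply: List.Forall_impl F1.
have [D [MD /List.Forall_cons_iff[Dv DF0]]] := icM (List.Forall_cons _ Mv MF0).
have rD : pieces_in remainder D.
  move=> i; apply: remainder_base; first exact: MD.
  case: (Dv) => A Av; case Ai : (A i); [left; exact: fsum_le Av Ai|right].
  apply: (@piece_disjoint _ D (pred1 i) A) Av _.
    exact: fsum_pred1.
  by move=> j /eqP ->; rewrite Ai.
have [D' [rD' _ D'F]] := hF D rD Dv DF0.
by exists D'; split=> // i; right; exact: rD'.
Qed.

End Adjoin.

(** ** Maximal internally compatible sets *)

Section Maximal.
Variables (E : effectAlgebra) (hE : homogeneous E) (M : set E).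
Hypotheses (M1 : M ea1) (icM : internally_compatible M).
Hypothesis maxM : forall M' : set E,
  M `<=` M' -> internally_compatible M' -> M' `<=` M.

Lemma maximal_below v t : M v -> t ≼ v -> t ≼ ea_compl v -> M t.
Proof.
move=> Mv tv tv'; apply: (maxM (@subsetUl _ M (remainder M v t))).
  exact: adjoin_compatible.
by right; apply: remainder_small; exact: ea_le_refl.
Qed.

Lemma maximal_ominus v c t e : M v -> t ≼ v -> t ≼ ea_compl v ->
  M c -> c ≼ v \/ c ≼ ea_compl v -> t ⊕ e = Some c -> M e.
Proof.
move=> Mv tv tv' Mc cv te; apply: (maxM (@subsetUl _ M (remainder M v t))).
  exact: adjoin_compatible.
right; apply: remainder_ominus te; [exact: remainder_base|exact: ea_le_refl].
Qed.

(** Covering [x] together with any finite part of [M] makes [M] with [x] adjoined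
    compatible; this is how [M] is seen to be closed under an operation. *)
Lemma maximal_covered x : (forall F, List.Forall M F ->
    exists D, [/\ pieces_in M D, List.Forall (covers D) F & covers D x]) -> M x.
Proof.
move=> hx; apply: (maxM (@subsetUl _ M [set x])); last by right.
move=> F MF.
have [F0 [MF0 hF]] : exists F0, List.Forall M F0 /\ forall D,
    covers D x -> List.Forall (covers D) F0 -> List.Forall (covers D) F.
  elim: MF => [|f {}F [Mf|->] _ [F0 [MF0 IH]]]; first by exists [::].
    exists (f :: F0); split; first by constructor.
    by move=> D Dx /List.Forall_cons_iff[Df /IH h]; constructor=> //; exact: h.
  by exists F0; split=> // D Dx DF0; constructor=> //; exact: IH.
have [D [MD DF Dx]] := hx F0 MF0.
by exists D; split; [move=> i; left; exact: MD|exact: hF].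
Qed.

Lemma maximal_compl x : M x -> M (ea_compl x).
Proof.
move=> Mx; apply: maximal_covered => F MF.
have [D [MD /List.Forall_cons_iff[Dx DF]]] := icM (List.Forall_cons _ Mx MF).
by exists D; split=> //; exact: covers_compl.
Qed.

Lemma maximal0 : M ea0.
Proof. by rewrite -compl1; exact: maximal_compl. Qed.

(** The sum [u] over the overlap is below [v1] and its complement, hence in [M].
    By orthogonality of [v1] and [v2] it is also below the sum [w] of the pieces
    outside both subfamilies.  Splitting these along [u] yields a second copy of
    [u], which replaces the overlap in the subfamily of [v2]. *)
Lemma disjoint_refinement D v1 v2 s : pieces_in M D -> M v1 ->
  covers D v1 -> covers D v2 -> v1 ⊕ v2 = Some s ->
  exists D', [/\ pieces_in M D', refines D D' &
   exists A1 A2 : pred (idx D'), [/\ fsum (@piece _ D') A1 = Some v1,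
     fsum (@piece _ D') A2 = Some v2 & forall i, A1 i -> A2 i -> False]].
Proof.
move=> MD Mv1 [A1 Av1] [A2 Av2] v12.
have Av1' := Av1; have Av2' := Av2.
move: Av1'; rewrite (fsumID _ A2) => /oaddP[u [p [hu hp up]]].
move: Av2'; rewrite (fsumID _ A1) => /oaddP[u' [q [hu' hq uq]]].
have uu' : u = u'.
  by apply/Some_inj; rewrite -hu -hu'; apply: eq_fsum => i /=; rewrite andbC.
rewrite -{u'}uu' in uq hu'.
set N := [pred i | ~~ (A1 i || A2 i)].
have [w hw _] := fsum_sub (piece_sum D) (P := N) (fun _ _ => isT).
have uw : u ≼ w.
  (* As v1 = u + p is below the complement p + w of v2, cancel p. *)
  have pw : p ⊕ w = Some (ea_compl v2).
    have := piece_sum D.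
    rewrite (fsumID _ A2) => /oaddP[a [b [ha hb /compl_eq]]].
    have -> : a = v2 by apply/Some_inj; rewrite -ha -Av2; exact: eq_fsum.
    move=> <-; rewrite -hb -[LHS]/(oadd (Some p) (Some w)) -hp -hw fsumU.
      by apply: eq_fsum => i /=; case: (A1 i); case: (A2 i).
    by move=> i /= /andP[-> _].
  have [r] := oplus_le_compl v12.
  move=> /(oplusA (oplusC up)) [x ur pr].
  by rewrite (oplus_cancel pw pr); exact: le_oplusl ur.
have uw' : u ≼ ea_compl w.
  apply: piece_disjoint hu hw _ => i /= /andP[a1 a2].
  by rewrite a1.
have Mu : M u.
  apply: (maximal_below Mv1); first exact: le_oplusl up.
  by apply: ea_le_trans (le_oplusl uq) _; exact: oplus_le_compl (oplusC v12).
have uu : u ≼ ea_compl u := ea_le_trans uw (le_complC uw').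
have [d [e [de du d0 dN]]] := homogeneous_split hE hw uw uw'.
exists (split_partition de); split.
- apply: pieces_in_split => i; case Ni : (N i); last first.
    by have [-> ->] := d0 i (negbT Ni); split; [exact: maximal0|exact: MD].
  have dui := du i Ni.
  split; first exact: maximal_below Mu dui (ea_le_trans dui uu).
  apply: (maximal_ominus Mu dui _ (MD i) _ (de i)).
    exact: ea_le_trans dui uu.
  right; exact: ea_le_trans (fsum_le hw Ni) (le_complC uw').
- exact: refines_split.
have cN : fsum (split_piece d e) [pred p | N p.1 && p.2] = Some u.
  by rewrite fsum_split_left.
exists [pred p | A1 p.1],
  [pred i | (N i.1 && i.2) || (A2 i.1 && ~~ A1 i.1)]; split.
- by rewrite -Av1; exact: fsum_split_piece.
- rewrite -uq -[RHS]/(oadd (Some u) (Some q)) -cN -hq.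
  rewrite -(fsum_split_piece de) fsumU //.
  by move=> [i b] /= /andP[/norP[/negbTE-> /negbTE->]].
- by move=> [i b] /= a1; rewrite a1 /= andbF.
Qed.

Lemma maximal_oplus v1 v2 s : M v1 -> M v2 -> v1 ⊕ v2 = Some s -> M s.
Proof.
move=> Mv1 Mv2 v12; apply: maximal_covered => F MF.
have [D [MD /List.Forall_cons_iff[D1 /List.Forall_cons_iff[D2 DF]]]] :=
  icM (List.Forall_cons _ Mv1 (List.Forall_cons _ Mv2 MF)).
have [D' [MD' DD' [A1 [A2 [h1 h2 dis]]]]] :=
  disjoint_refinement MD Mv1 D1 D2 v12.
exists D'; split=> //; first by apply: List.Forall_impl DF.
exists [pred i | A1 i || A2 i].
by rewrite -fsumU// h1 h2.
Qed.

Lemma maximal_sub a b c : M a -> M b -> b ⊕ c = Some a -> M c.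
Proof.
move=> Ma Mb /oplusC /oplus_rot h; rewrite -(complK c); apply: maximal_compl.
exact: maximal_oplus Mb (maximal_compl Ma) h.
Qed.

(** With disjoint subfamilies for [v1] and [v2], only the part [z] of [u]
    outside both remains to be split; it is below the unused part of [v1] and
    [v2] and orthogonal to it, so homogeneity applies, and the components of [z] are in
    [M] because [z] is orthogonal to itself. *)
Lemma maximal_riesz : riesz2 M.
Proof.
move=> u v1 v2 s Mu Mv1 Mv2 Ms v12 us.
have [D0 [MD0 hD0]] :
    exists D, pieces_in M D /\ List.Forall (covers D) [:: v1; v2; u].
  by apply: icM; repeat constructor.
move: hD0 => /List.Forall_cons_iff[D1].
move=> /List.Forall_cons_iff[D2 /List.Forall_cons_iff[Du _]].
have [D [MD DD [A1 [A2 [h1 h2 dis]]]]] := disjoint_refinement MD0 Mv1 D1 D2 v12.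
have {Du} [J hJ] := DD _ Du.
have sub (P : pred (idx D)) : exists2 t, fsum (@piece _ D) P = Some t & M t.
  have [t ht _] := fsum_sub (piece_sum D) (P := P) (fun _ _ => isT).
  exists t => //; apply: fsum_in ht => //; first exact: maximal0.
  exact: maximal_oplus.
(* u is the sum of j1, j2 and z; the parts of v1 and v2 outside u are r1, r2. *)
have [j1 hj1 Mj1] := sub [pred i | A1 i && J i].
have [j2 hj2 Mj2] := sub [pred i | A2 i && J i].
have [r1 hr1 Mr1] := sub [pred i | A1 i && ~~ J i].
have [r2 hr2 Mr2] := sub [pred i | A2 i && ~~ J i].
have [z hz Mz] := sub [pred i | J i && ~~ (A1 i || A2 i)].
have e1 : j1 ⊕ r1 = Some v1 by rewrite -h1 (fsumID _ J) hj1 hr1.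
have e2 : j2 ⊕ r2 = Some v2 by rewrite -h2 (fsumID _ J) hj2 hr2.
have eu : oadd (oadd (Some j1) (Some j2)) (Some z) = Some u.
  rewrite -hJ (fsumID _ [pred i | A1 i || A2 i]) hz -hj1 -hj2 fsumU; last first.
    by move=> i /= /andP[a1 _] /andP[a2 _]; exact: dis a1 a2.
  congr oadd; apply: eq_fsum => i /=.
  by case: (A1 i); case: (A2 i); case: (J i).
have es : oadd (oadd (Some j1) (Some j2)) (oadd (Some r1) (Some r2)) = Some s.
  by rewrite oaddACA /= e1 e2.
have [j [_ [hj [<-] jz]]] := oaddP eu.
have [_ [y [[<-] hy jy]]] : exists a b,
    [/\ Some j = Some a, oadd (Some r1) (Some r2) = Some b & a ⊕ b = Some s].
  by apply: oaddP; rewrite -hj.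
have zy : z ≼ y.
  case: us => x ux; have [w zx jw] := oplusA jz ux.
  by rewrite (oplus_cancel jy jw); exact: le_oplusl zx.
have zy' : z ≼ ea_compl y.
  have hy2 : fsum (@piece _ D)
      [pred i | (A1 i && ~~ J i) || (A2 i && ~~ J i)] = Some y.
    rewrite -hy -hr1 -hr2 fsumU // => i /= /andP[a1 _] /andP[a2 _].
    exact: dis a1 a2.
  apply: piece_disjoint hz hy2 _ => i /= /andP[-> _].
  by rewrite !andbF.
have [z1 [z2 [z1r z2r zz]]] := hE hy zy zy'.
have zz' : z ≼ ea_compl z := ea_le_trans zy (le_complC zy').
have Mz1 : M z1.
  have h := le_oplusl zz; exact: maximal_below Mz h (ea_le_trans h zz').
have Mz2 : M z2.
  have h := le_oplusr zz; exact: maximal_below Mz h (ea_le_trans h zz').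
have eu2 : oadd (oadd (Some j1) (Some z1)) (oadd (Some j2) (Some z2)) = Some u.
  by rewrite oaddACA [oadd (Some z1) _]zz.
have [u1 [u2 [hu1 hu2 u12]]] := oaddP eu2.
have mono a b c d t :
    b ≼ c -> oadd (Some a) (Some b) = Some t -> a ⊕ c = Some d -> t ≼ d.
  move=> [x bx] /= abt ac.
  have /oaddP[t' [_ [h _ /le_oplusl]]] :
      oadd (oadd (Some a) (Some b)) (Some x) = Some d.
    by rewrite -oaddA /= bx.
  by move: h; rewrite /= abt => -[->].
exists u1, u2; split=> //; split.
- exact: maximal_oplus Mj1 Mz1 hu1.
- exact: mono z1r hu1 e1.
- exact: maximal_oplus Mj2 Mz2 hu2.
- exact: mono z2r hu2 e2.
Qed.

End Maximal.

(** Compatibility is a condition on finite subsets, hence passes to unions of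
    chains. *)
Lemma maximal_compatible_ext (E : effectAlgebra) (B : set E) :
  internally_compatible B -> exists M, [/\ B `<=` M, internally_compatible M &
    forall M', M `<=` M' -> internally_compatible M' -> M' `<=` M].
Proof.
move=> icB.
(* The empty chain has empty union, so [B] is joined to each set rather than
   required to be a subset. *)
have [|A [icA maxA]] :=
  @Zorn_bigcup E [set A | internally_compatible (B `|` A)].
  move=> /= C icC totC F FC.
  have [FB|[X [CX FX]]] :
      List.Forall B F \/ exists X, C X /\ List.Forall (B `|` X) F.
    elim: FC => [|f {}F hf _]; first by left; constructor.
    case: hf => [Bf|[Y CY Yf]] [FB|[X [CX FX]]].
    - by left; constructor.
    - by right; exists X; split=> //; constructor=> //; left.
    - right; exists Y; split=> //; constructor; first by right.
      by apply: List.Forall_impl FB => x; left.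
    - right; have [XY|YX] := totC X Y CX CY.
        exists Y; split=> //; constructor; first by right.
        by apply: List.Forall_impl FX => x [|/XY]; [left|right].
      exists X; split=> //; constructor=> //; right; exact: YX.
  - have [D [BD DF]] := icB F FB; exists D; split=> // i; left; exact: BD.
  - have [D [XD DF]] := icC X CX F FX; exists D; split=> // i.
    by case: (XD i) => [|h]; [left|right; exists X].
exists (B `|` A); split; [by move=> x; left|exact: icA|].
move=> M' MM' icM' x M'x; right.
have [//|nAx] := pselect (A x).
have AM' : A `<` M'.
  split; first by apply: subset_trans MM'; exact: subsetUr.
  by move=> M'A; exact/nAx/M'A.
case: (maxA M' AM') => /=.
by rewrite (_ : B `|` M' = M') //; apply/setUidPr => y By; apply: MM'; left.
Qed.

(** * Blocks *)

Lemma block_below (E : effectAlgebra) (hE : homogeneous E) (B : subEA E) :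
  block B ->
  forall v t, subEA_set B v -> t ≼ v -> t ≼ ea_compl v -> subEA_set B t.
Proof.
move=> [/riesz_induced rB maxB] v t Bv tv tv'.
have [M [BM icM maxM]] := maximal_compatible_ext (riesz_compatible rB).
have M1 : M ea1 by exact/BM/subEA1.
have Mt := maximal_below hE icM maxM (BM _ Bv) tv tv'.
apply: (maxB (SubEA M1 (maximal_sub hE M1 icM maxM))) => //.
by apply/riesz_induced; exact: maximal_riesz.
Qed.

(** A lower bound in [E] of [x] and its complement already lies in [B]. *)
Lemma block_sharp (E : effectAlgebra) (hE : homogeneous E) (B : subEA E) :
  block B -> forall x : induced B, sharp x <-> sharp (subEA_incl x).
Proof.
move=> bB x; split=> sx t tx tx'.
  have [y ty] := subEA_incl_onto (block_below hE bB (subEA_inclP x) tx tx').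
  rewrite -ty (sx y) //; first by apply/le_induced; rewrite ty.
  by apply/le_induced; rewrite compl_induced ty.
apply: subEA_incl_inj; apply: sx; first exact/le_induced.
by rewrite -compl_induced; exact/le_induced.
Qed.

Section SharpPart.
Variables (E : effectAlgebra) (hE : homogeneous E) (B : subEA E).
Let sE := induced (sharpEA hE).

Definition sharp_part : subEA sE.
Proof.
apply: (@SubEA sE [set x | subEA_set B (subEA_incl x)]).
  exact: subEA1.
by move=> a b c /= Ba Bb /oplus_induced; exact: subEA_ominus.
Defined.

Lemma sharp_part_riesz : block B -> riesz2 (subEA_set sharp_part).
Proof.
move=> bB u v1 v2 s /= Bu Bv1 Bv2 Bs /oplus_induced v12 /le_induced us.
have rF := (riesz2_setT (induced B)).1 bB.1.
have lift (x : sE) : subEA_set B (subEA_incl x) ->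
    exists2 y : induced B, subEA_incl y = subEA_incl x & sharp y.
  move=> /subEA_incl_onto[y yx]; exists y => //; apply/(block_sharp hE bB).
  by rewrite yx; exact: subEA_inclP x.
have [u' uE su] := lift _ Bu; have [v1' v1E sv1] := lift _ Bv1.
have [v2' v2E sv2] := lift _ Bv2; have [s' sE' _] := lift _ Bs.
move: v12 us; rewrite -uE -v1E -v2E -sE' => /oplus_induced v12 /le_induced us.
have [u1 [u2 [[_ h1] [_ h2] u12]]] := rF _ _ _ _ I I I I v12 us.
have lower (x : induced B) : sharp x ->
    exists2 y : sE, subEA_incl y = subEA_incl x & subEA_set sharp_part y.
  move=> /(block_sharp hE bB) sx.
  have [y yx] := @subEA_incl_onto E (sharpEA hE) _ sx.
  by exists y => //=; rewrite yx; exact: subEA_inclP.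
have [w1 w1E Bw1] := lower _ (sharp_split rF su sv2 v12 h1 h2 u12).
have [w2 w2E Bw2] :=
  lower _ (sharp_split rF su sv1 (oplusC v12) h2 h1 (oplusC u12)).
exists w1, w2; split.
- by split=> //; apply/le_induced; rewrite w1E -v1E; exact/le_induced.
- by split=> //; apply/le_induced; rewrite w2E -v2E; exact/le_induced.
- by apply/oplus_induced; rewrite w1E w2E -uE; exact/oplus_induced.
Qed.

End SharpPart.

Theorem proposition4p5 (E : effectAlgebra) (hE : homogeneous E)
    (B0 : subEA (induced (sharpEA hE))) (B : subEA E)
    (hB0 : block B0) (hB : block B)
    (hB0B : [set subEA_incl x | x in subEA_set B0] `<=` subEA_set B) :
  [set subEA_incl x | x in subEA_set B0]
  = [set subEA_incl x | x in center (induced B)].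
Proof.
have rF := (riesz2_setT (induced B)).1 hB.1.
apply/seteqP; split=> [_ [x B0x <-]|_ [y /central_sharp /(block_sharp hE hB) sy <-]].
  have [y yx] := subEA_incl_onto (hB0B _ (ex_intro2 _ _ x B0x erefl)).
  exists y => //; apply: (sharp_central rF); apply/(block_sharp hE hB).
  by rewrite yx; exact: subEA_inclP x.
have [x xy] := @subEA_incl_onto E (sharpEA hE) _ sy.
exists x => //; apply: (hB0.2 (sharp_part hE B)).
- by apply/riesz_induced; exact: sharp_part_riesz.
- by move=> z B0z; apply: hB0B; exists z.
- by rewrite /= xy; exact: subEA_inclP.
Qed.
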